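(* Let $\mathbb S$ and $\mathbb S'$ be Gr-categories of type $(\Pi,A,h)$ and $(\Pi',A',h')$ respectively, and let $F:\mathbb S\to\mathbb S'$ be a functor of type $(\varphi,f)$ with obstruction $k=\varphi^*h'-f_*h$. Then $F$ induces a Gr-functor (that is, there is $\widetilde F$ making $(F,\widetilde F)$ a Gr-functor $\mathbb S\to\mathbb S'$) if and only if $[k]=0$ in $H^3(\Pi,A')$. In that case there exist bijections (i) $\operatorname{Hom}_{(\varphi,f)}[\mathbb S,\mathbb S']\to H^2(\Pi,A')$; (ii) $\operatorname{Aut}(F)\to Z^1(\Pi,A')$, for $F=(F,\widetilde F)$ a Gr-functor of type $(\varphi,f)$.
   Context: A Gr-category is a monoidal category in which every object is invertible and every morphism is an isomorphism; a Gr-functor $(F,\widetilde F)$ is a monoidal functor between Gr-categories, with natural isomorphisms $\widetilde F_{X,Y}:FX\otimes FY\to F(X\otimes Y)$ and an isomorphism $F_*:I'\to FI$ (determined by $F$ and $\widetilde F$) compatible with associativity and unit constraints. A homotopy $\alpha:(F,\widetilde F,F_* )\to(K,\widetilde K,K_* )$ is a natural isomorphism $\alpha:F\to K$ with $K_*=\alpha_I\circ F_*$ and $\alpha_{X\otimes Y}\circ\widetilde F_{X,Y}=\widetilde K_{X,Y}\circ(\alpha_X\otimes\alpha_Y)$. For a group $\Pi$, a $\Pi$-module $A$ and a normalized 3-cocycle $h\in Z^3(\Pi,A)$, the Gr-category of type $(\Pi,A,h)$ has objects $x\in\Pi$, morphisms only the automorphisms $(x,a):x\to x$ with $a\in A$,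 composition $(x,a)(x,b)=(x,a+b)$, tensor product $x\otimes y=xy$, $(x,a)\otimes(y,b)=(xy,a+xb)$, identity unit constraints, and associativity constraint $(xyz,h(x,y,z)):x\otimes(y\otimes z)\to(x\otimes y)\otimes z$. A functor $F:\mathbb S\to\mathbb S'$ is of type $(\varphi,f)$ if $F(x)=\varphi(x)$ and $F(x,a)=(\varphi(x),f(a))$, where $\varphi:\Pi\to\Pi'$ and $f:A\to A'$ are group homomorphisms with $f(xa)=\varphi(x)f(a)$. $A'$ is regarded as a $\Pi$-module via $xa'=\varphi(x)a'$. Here $(\varphi^*h')(x,y,z)=h'(\varphi x,\varphi y,\varphi z)$ and $(f_*h)(x,y,z)=f(h(x,y,z))$. $\operatorname{Hom}_{(\varphi,f)}[\mathbb S,\mathbb S']$ denotes the set of homotopy classes of Gr-functors $\mathbb S\to\mathbb S'$ of type $(\varphi,f)$. $\operatorname{Aut}(F)$ denotes the set of homotopies from the Gr-functor $(F,\widetilde F)$ to itself. $Z^1(\Pi,A')$ is the group of 1-cocycles (crossed homomorphisms). *)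

(* Defs.v *)
From HB Require Import structures.
From mathcomp Require Import all_boot all_order all_algebra ssrAC.
From mathcomp Require Import ring_quotient.
From mathcomp Require Import boolp functions.

Set Implicit Arguments.
Unset Strict Implicit.
Unset Printing Implicit Defensive.

Import GRing.Theory.
Local Open Scope quotient_scope.
Local Open Scope ring_scope.

Lemma multiplicative1 (G G' : groupType) (phi : {multiplicative G -> G'}) :
  phi 1%g = 1%g.
Proof. by apply: (mulgI (phi 1%g)); rewrite -gmulfM !mulg1. Qed.

Record gModule (G : groupType) := GModule {
  gmod_sort :> zmodType;
  act : G -> gmod_sort -> gmod_sort;
  actD : forall x, {morph act x : a b / a + b};
  act1 : forall a, act 1%g a = a;
  actM : forall x y a, act (x * y)%g a = act x (act y a)
}.

Section ActionTheory.
Variables (G : groupType) (A : gModule G).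
Implicit Types (x : G) (a b : A).

Lemma act0 x : act x (0 : A) = 0.
Proof. by apply: (addIr (act x 0)); rewrite -actD !add0r. Qed.

Lemma actN x a : act x (- a) = - act x a.
Proof. by apply: (addIr (act x a)); rewrite -actD !addNr act0. Qed.

Lemma actB x a b : act x (a - b) = act x a - act x b.
Proof. by rewrite actD actN. Qed.

End ActionTheory.

Section Restriction.
Variables (G G' : groupType) (phi : {multiplicative G -> G'}) (A' : gModule G').

Fact restr_actD x : {morph @act G' A' (phi x) : a b / a + b}.
Proof. exact: actD. Qed.
Fact restr_act1 a : @act G' A' (phi 1%g) a = a.
Proof. by rewrite multiplicative1 act1. Qed.
Fact restr_actM x y a :
  @act G' A' (phi (x * y)%g) a = act (phi x) (act (phi y) a).
Proof. by rewrite gmulfM actM. Qed.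

Definition restr : gModule G := GModule restr_actD restr_act1 restr_actM.

End Restriction.

Definition cochain (G : groupType) (n : nat) (A : gModule G) : Type :=
  n.-tuple G -> A.

HB.instance Definition _ (G : groupType) n (A : gModule G) :=
  GRing.Zmodule.copy (cochain n A) (n.-tuple G -> A).

Section Cohomology.
Variables (G : groupType) (A : gModule G).

Definition merge_at n (i : nat) (x : n.+1.-tuple G) : n.-tuple G :=
  [tuple if (j < i)%N then nth 1%g x j
         else if j == i :> nat then (nth 1 x j * nth 1 x j.+1)%g
         else nth 1%g x j.+1 | j < n].

Definition delta n (f : cochain n A) : cochain n.+1 A := fun x =>
  act (thead x) (f [tuple of behead x])
  + \sum_(i < n) f (merge_at i x) *~ (-1) ^+ i.+1
  + f [tuple of belast (thead x) (behead x)] *~ (-1) ^+ n.+1.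

Lemma cochainBE n (f g : cochain n A) x : (f - g) x = f x - g x.
Proof. by []. Qed.

Lemma deltaB n (f g : cochain n A) : delta (f - g) = delta f - delta g.
Proof.
apply/funext => x; rewrite cochainBE /delta !cochainBE actB mulrzBl.
under eq_bigr do rewrite cochainBE mulrzBl.
by rewrite sumrB !opprD [act _ _ - _ + _]addrACA [LHS]addrACA.
Qed.

Definition cocycle_pred n : {pred cochain n A} := fun f => delta f == 0.
Arguments cocycle_pred : clear implicits.

Fact cocycle_zmod_closed n : zmod_closed (cocycle_pred n).
Proof.
split=> [|f g]; first by rewrite -(subrr 0) unfold_in deltaB subrr.
by rewrite !unfold_in deltaB => /eqP-> /eqP->; rewrite subrr.
Qed.
HB.instance Definition _ n :=
  GRing.isZmodClosed.Build (cochain n A) (cocycle_pred n)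
    (cocycle_zmod_closed n).

Record cocycle n := Cocycle {
  cocycle_val :> cochain n A;
  _ : cocycle_val \in cocycle_pred n
}.
HB.instance Definition _ n := [isSub for @cocycle_val n].
HB.instance Definition _ n := [Choice of cocycle n by <:].
HB.instance Definition _ n := [SubChoice_isSubZmodule of cocycle n by <:].

(* In [cohomology] this predicate is only ever applied to cocycles. *)
Definition is_coboundary n : cochain n A -> Prop :=
  if n is m.+1 then fun f => exists g : cochain m A, delta g = f
  else fun f => f = 0.

Definition coboundary_pred n : {pred cocycle n} :=
  fun z => `[< is_coboundary z >].

Fact coboundary_zmod_closed n : zmod_closed (@coboundary_pred n).
Proof.
split=> [|z t]; rewrite !unfold_in.
  apply/asboolP; case: n => //= n; exists 0.
  by rewrite -(subrr 0) deltaB subrr.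
move=> /asboolP zB /asboolP tB; apply/asboolP.
case: n z t zB tB => [|n] z t /=; first by move=> -> ->; rewrite subrr.
by move=> [f df] [g dg]; exists (f - g); rewrite deltaB df dg.
Qed.
HB.instance Definition _ n :=
  GRing.isZmodClosed.Build (cocycle n) (@coboundary_pred n)
    (@coboundary_zmod_closed n).

Definition cohomology n : Type := Quotient.quot (@coboundary_pred n).
HB.instance Definition _ n := GRing.Zmodule.on (cohomology n).

Definition coh_class n (z : cocycle n) : cohomology n :=
  \pi_(Quotient.quot (@coboundary_pred n)) z.

Lemma coh_class_eq n (z t : cocycle n) :
  coh_class z = coh_class t <-> is_coboundary (cocycle_val z - cocycle_val t).
Proof.
split=> [/eqP|].
  by rewrite -Quotient.idealrBE unfold_in => /asboolP.
move=> zt; apply/eqP; rewrite -Quotient.idealrBE unfold_in.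
exact/asboolP.
Qed.

Lemma coh_class_eq0 n (z : cocycle n) :
  coh_class z = 0 <-> is_coboundary (cocycle_val z).
Proof.
have -> : 0 = coh_class (0 : cocycle n) by rewrite /coh_class raddf0.
by rewrite coh_class_eq subr0.
Qed.

Definition normalized n (f : cochain n A) :=
  forall x : n.-tuple G, 1%g \in (x : seq G) -> f x = 0.

Lemma merge_atE n i (x : n.+1.-tuple G) (y : n.-tuple G) :
    (forall j, j < n -> nth 1%g y j =
      if (j < i)%N then nth 1%g x j
      else if j == i then (nth 1 x j * nth 1 x j.+1)%g
      else nth 1%g x j.+1)%N ->
  merge_at i x = y.
Proof.
move=> xy; apply: eq_from_tnth => j.
by rewrite tnth_mktuple (tnth_nth 1%g) xy.
Qed.

Lemma delta1E (f : cochain 1 A) x y :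
  delta f [tuple x; y] =
  act x (f [tuple y]) - f [tuple (x * y)%g] + f [tuple x].
Proof.
rewrite /delta big_ord_recl big_ord0 /= addr0.
rewrite (@merge_atE _ _ _ [tuple (x * y)%g]); last by case.
rewrite !(exprS, expr0, mulN1r, opprK) !mulr1z !mulrN1z.
congr (act _ (f _) - f _ + f _); exact: val_inj.
Qed.

Lemma delta2E (f : cochain 2 A) x y z :
  delta f [tuple x; y; z] =
  act x (f [tuple y; z]) - f [tuple (x * y)%g; z] + f [tuple x; (y * z)%g]
  - f [tuple x; y].
Proof.
rewrite /delta !big_ord_recl big_ord0 /= addr0 addrA.
rewrite (@merge_atE _ _ _ [tuple (x * y)%g; z]); last by do 2?[case=> //].
rewrite (@merge_atE _ _ _ [tuple x; (y * z)%g]); last by do 2?[case=> //].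
rewrite !(exprS, expr0, mulN1r, opprK) !mulr1z !mulrN1z.
congr (act _ (f _) - f _ + f _ - f _); exact: val_inj.
Qed.

Lemma delta3E (f : cochain 3 A) x y z t :
  delta f [tuple x; y; z; t] =
  act x (f [tuple y; z; t]) - f [tuple (x * y)%g; z; t]
  + f [tuple x; (y * z)%g; t] - f [tuple x; y; (z * t)%g] + f [tuple x; y; z].
Proof.
rewrite /delta !big_ord_recl big_ord0 /= addr0 !addrA.
rewrite (@merge_atE _ _ _ [tuple (x * y)%g; z; t]); last by do 3?[case=> //].
rewrite (@merge_atE _ _ _ [tuple x; (y * z)%g; t]); last by do 3?[case=> //].
rewrite (@merge_atE _ _ _ [tuple x; y; (z * t)%g]); last by do 3?[case=> //].
rewrite !(exprS, expr0, mulN1r, opprK) !mulr1z !mulrN1z.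
congr (act _ (f _) - f _ + f _ - f _ + f _);
  exact: val_inj.
Qed.

Lemma cocycle1P (z : cocycle 1) x y :
  cocycle_val z [tuple (x * y)%g] =
  cocycle_val z [tuple x] + act x (cocycle_val z [tuple y]).
Proof.
case: z => z /= /eqP/(congr1 (fun g => g [tuple x; y])).
rewrite delta1E => /eqP; rewrite addrAC subr_eq0 addrC => /eqP <-.
by rewrite addrC.
Qed.

End Cohomology.

Arguments merge_at {G n} i x.
Arguments cocycle_pred {G} A n _.
Arguments coh_class {G A n} z.

Section Functoriality.

Variables (G G' : groupType) (phi : {multiplicative G -> G'}).

Definition pull_cochain n (A' : gModule G') (f : cochain n A') :
  cochain n (restr phi A') := fun x => f [tuple of map phi x].

Fact pull_cocycle_subproof n (A' : gModule G') (z : cocycle A' n) :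
  pull_cochain z \in cocycle_pred (restr phi A') n.
Proof.
rewrite unfold_in; apply/eqP/funext => x.
have /eqP/(congr1 (fun g => g [tuple of map phi x])) z0 := valP z.
apply: (etrans _ z0); clear z0; rewrite /delta /pull_cochain /=.
congr (_ + _ + _ *~ _).
- congr (act _ (cocycle_val z _)); first by case/tupleP: x.
  by apply: val_inj; rewrite /= behead_map.
- apply: eq_bigr => i _; congr (cocycle_val z _ *~ _).
  apply/esym/merge_atE => j jn; rewrite (nth_map 1%g) ?size_tuple ?card_ord //.
  have -> : nth 1%g (merge_at i x) j = tnth (merge_at i x) (Ordinal jn).
    by rewrite (tnth_nth 1%g).
  rewrite tnth_mktuple /=.
  rewrite !(nth_map 1%g) ?size_tuple ?card_ord ?ltnS ?(ltnW jn) // -gmulfM.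
  by do 2?case: ifP.
- congr (cocycle_val z _); apply: val_inj.
  by case/tupleP: x => a x; rewrite /thead !(tnth_nth 1%g) /= belast_map.
Qed.

Definition pull_cocycle n (A' : gModule G') (z : cocycle A' n) :
  cocycle (restr phi A') n := Cocycle (pull_cocycle_subproof z).

Variables (A B : gModule G) (f : {additive A -> B}).
Hypothesis f_act : forall x a, f (act x a) = act x (f a).

Definition push_cochain n (c : cochain n A) : cochain n B := fun x => f (c x).

Fact push_cocycle_subproof n (z : cocycle A n) :
  push_cochain z \in cocycle_pred B n.
Proof.
rewrite unfold_in; apply/eqP/funext => x.
have /eqP/(congr1 (fun g => f (g x))) z0 := valP z.
apply: (etrans _ (etrans z0 (raddf0 f))); rewrite /delta /push_cochain /=.
rewrite !raddfD /= f_act raddf_sum (raddfMz f).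
by under [in RHS]eq_bigr do rewrite (raddfMz f).
Qed.

Definition push_cocycle n (z : cocycle A n) : cocycle B n :=
  Cocycle (push_cocycle_subproof z).

End Functoriality.

Declare Scope cat_scope.
Delimit Scope cat_scope with cat.
Local Open Scope cat_scope.
Reserved Notation "X \ox Y" (at level 45, left associativity).
Reserved Notation "u \om v" (at level 45, left associativity).
Reserved Notation "u \oc v" (at level 50, left associativity).

Record category := Category {
  obj :> Type;
  hom : obj -> obj -> Type;
  idm : forall X, hom X X;
  comp : forall X Y Z, hom Y Z -> hom X Y -> hom X Z;
  comp1m : forall X Y (u : hom X Y), comp (idm Y) u = u;
  compm1 : forall X Y (u : hom X Y), comp u (idm X) = u;
  compA : forall X Y Z T (w : hom Z T) (v : hom Y Z) (u : hom X Y),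
    comp w (comp v u) = comp (comp w v) u
}.
Arguments hom {c} X Y.
Arguments idm {c} X.
Arguments comp {c X Y Z} v u.
Notation "v \oc u" := (comp v u) : cat_scope.

Definition is_iso (C : category) (X Y : C) (u : hom X Y) :=
  exists v : hom Y X, v \oc u = idm X /\ u \oc v = idm Y.

Record monoidal := Monoidal {
  mon_cat :> category;
  unit_obj : mon_cat;
  tens : mon_cat -> mon_cat -> mon_cat;
  tensm : forall X X' Y Y' : mon_cat,
    hom X X' -> hom Y Y' -> hom (tens X Y) (tens X' Y');
  tensm1 : forall X Y, tensm (idm X) (idm Y) = idm (tens X Y);
  tensmM : forall X X' X'' Y Y' Y'' (u' : hom X' X'') (u : hom X X')
      (v' : hom Y' Y'') (v : hom Y Y'),
    tensm (u' \oc u) (v' \oc v) = tensm u' v' \oc tensm u v;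
  asso : forall X Y Z, hom (tens X (tens Y Z)) (tens (tens X Y) Z);
  lunit : forall X, hom (tens unit_obj X) X;
  runit : forall X, hom (tens X unit_obj) X;
  asso_iso : forall X Y Z, is_iso (asso X Y Z);
  lunit_iso : forall X, is_iso (lunit X);
  runit_iso : forall X, is_iso (runit X);
  asso_nat : forall X X' Y Y' Z Z' (u : hom X X') (v : hom Y Y') (w : hom Z Z'),
    asso X' Y' Z' \oc tensm u (tensm v w)
    = tensm (tensm u v) w \oc asso X Y Z;
  lunit_nat : forall X X' (u : hom X X'),
    lunit X' \oc tensm (idm unit_obj) u = u \oc lunit X;
  runit_nat : forall X X' (u : hom X X'),
    runit X' \oc tensm u (idm unit_obj) = u \oc runit X;
  pentagon : forall X Y Z T,
    tensm (asso X Y Z) (idm T) \oc asso X (tens Y Z) T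
      \oc tensm (idm X) (asso Y Z T)
    = asso (tens X Y) Z T \oc asso X Y (tens Z T);
  triangle : forall X Y,
    tensm (runit X) (idm Y) \oc asso X unit_obj Y = tensm (idm X) (lunit Y)
}.
Arguments unit_obj {m}.
Arguments tens {m} X Y.
Arguments tensm {m X X' Y Y'} u v.
Notation "X \ox Y" := (tens X Y) : cat_scope.
Notation "u \om v" := (tensm u v) : cat_scope.

Definition invertible (C : monoidal) (X : C) := exists Y : C,
  (exists u : hom (X \ox Y) unit_obj, is_iso u) /\
  (exists v : hom (Y \ox X) unit_obj, is_iso v).

Record gr_category := GrCategory {
  gr_mon :> monoidal;
  gr_invertible : forall X : gr_mon, invertible X;
  gr_iso : forall (X Y : gr_mon) (u : hom X Y), is_iso u
}.

Record functor (C D : category) := Functor {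
  fobj :> C -> D;
  fmap : forall X Y, hom X Y -> hom (fobj X) (fobj Y);
  fmap1 : forall X, fmap (idm X) = idm (fobj X);
  fmapM : forall X Y Z (v : hom Y Z) (u : hom X Y),
    fmap (v \oc u) = fmap v \oc fmap u
}.
Arguments fmap {C D} F {X Y} u : rename.

Record mon_structure (C D : monoidal) (F : functor C D) := MonStructure {
  mtens : forall X Y, hom (F X \ox F Y) (F (X \ox Y));
  munit : hom unit_obj (F unit_obj);
  mtens_iso : forall X Y, is_iso (mtens X Y);
  munit_iso : is_iso munit;
  mtens_nat : forall X X' Y Y' (u : hom X X') (v : hom Y Y'),
    mtens X' Y' \oc (fmap F u \om fmap F v) = fmap F (u \om v) \oc mtens X Y;
  mtens_asso : forall X Y Z,
    fmap F (asso X Y Z) \oc mtens X (Y \ox Z) \oc (idm (F X) \om mtens Y Z)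
    = mtens (X \ox Y) Z \oc (mtens X Y \om idm (F Z))
      \oc asso (F X) (F Y) (F Z);
  mtens_lunit : forall X,
    fmap F (lunit X) \oc mtens unit_obj X \oc (munit \om idm (F X))
    = lunit (F X);
  mtens_runit : forall X,
    fmap F (runit X) \oc mtens X unit_obj \oc (idm (F X) \om munit)
    = runit (F X)
}.

Record gr_functor (S S' : gr_category) := GrFunctor {
  gr_fun :> functor S S';
  gr_struct : mon_structure gr_fun
}.
Notation tensF F := (mtens (gr_struct F)).
Notation unitF F := (munit (gr_struct F)).

Record homotopy (S S' : gr_category) (F K : gr_functor S S') := Homotopy {
  hcomp :> forall X, hom (F X) (K X);
  hcomp_iso : forall X, is_iso (hcomp X);
  hcomp_nat : forall X Y (u : hom X Y),
    hcomp Y \oc fmap F u = fmap K u \oc hcomp X;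
  hcomp_unit : unitF K = hcomp unit_obj \oc unitF F;
  hcomp_tens : forall X Y,
    hcomp (X \ox Y) \oc tensF F X Y = tensF K X Y \oc (hcomp X \om hcomp Y)
}.

Definition homotopic (S S' : gr_category) (F K : gr_functor S S') : Prop :=
  inhabited (homotopy F K).

Section Homotopic.
Variables S S' : gr_category.
Implicit Types F K L : gr_functor S S'.

Lemma homotopic_refl F : homotopic F F.
Proof.
constructor; exists (fun X => idm (F X)) => [X|X Y u||X Y].
- by exists (idm _); rewrite comp1m.
- by rewrite comp1m compm1.
- by rewrite comp1m.
- by rewrite tensm1 comp1m compm1.
Qed.

Lemma homotopic_trans F K L : homotopic F K -> homotopic K L -> homotopic F L.
Proof.
move=> [al] [be]; constructor.
exists (fun X => be X \oc al X) => [X|X Y u||X Y].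
- exact: gr_iso.
- by rewrite -compA hcomp_nat !compA hcomp_nat.
- by rewrite -compA -!hcomp_unit.
- by rewrite tensmM -compA hcomp_tens !compA hcomp_tens.
Qed.

Lemma homotopic_sym F K : homotopic F K -> homotopic K F.
Proof.
move=> [al].
have inv X := cid (hcomp_iso al X).
pose be X := projT1 (inv X).
have beal X : be X \oc al X = idm (F X) by case: (projT2 (inv X)).
have albe X : al X \oc be X = idm (K X) by case: (projT2 (inv X)).
constructor; exists be => [X|X Y u||X Y].
- exact: gr_iso.
- rewrite -[fmap K u]compm1 -(albe X) (compA (fmap K u)) -hcomp_nat.
  by rewrite !compA beal comp1m.
- by rewrite (hcomp_unit al) compA beal comp1m.
- rewrite -[tensF K X Y]compm1 -tensm1 -!albe tensmM.
  by rewrite (compA (tensF K X Y)) -hcomp_tens !compA beal comp1m.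
Qed.

End Homotopic.

Section GrCategoryOfType.
Variables (G : groupType) (A : gModule G).

(* There is no morphism from [x] to [y] unless [x = y], and the morphisms
   [(x, a) : x -> x] are the [GrHom erefl a]. *)
Record gr_hom (x y : G) := GrHom { gr_hom_eq : x = y; gr_val : A }.

Lemma gr_hom_inj x y : injective (@gr_val x y).
Proof.
move=> [e a] [e' b] /= ->.
by rewrite (Prop_irrelevance e e').
Qed.

Definition gr_id x : gr_hom x x := GrHom erefl 0.
Definition gr_comp x y z (v : gr_hom y z) (u : gr_hom x y) : gr_hom x z :=
  GrHom (etrans (gr_hom_eq u) (gr_hom_eq v)) (gr_val v + gr_val u).
Definition gr_tensm x x' y y' (u : gr_hom x x') (v : gr_hom y y') :
    gr_hom (x * y)%g (x' * y')%g :=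
  GrHom (f_equal2 *%g (gr_hom_eq u) (gr_hom_eq v))
        (gr_val u + act x (gr_val v)).

Fact gr_comp1m x y (u : gr_hom x y) : gr_comp (gr_id y) u = u.
Proof. by apply: gr_hom_inj; rewrite /= add0r. Qed.
Fact gr_compm1 x y (u : gr_hom x y) : gr_comp u (gr_id x) = u.
Proof. by apply: gr_hom_inj; rewrite /= addr0. Qed.
Fact gr_compA x y z t (w : gr_hom z t) (v : gr_hom y z) (u : gr_hom x y) :
  gr_comp w (gr_comp v u) = gr_comp (gr_comp w v) u.
Proof. by apply: gr_hom_inj; rewrite /= addrA. Qed.

Definition gr_cat : category := Category gr_comp1m gr_compm1 gr_compA.

Variables (h : cocycle A 3) (hn : normalized h).

Definition gr_asso x y z : gr_hom (x * (y * z))%g (x * y * z)%g :=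
  GrHom (mulgA x y z) (cocycle_val h [tuple x; y; z]).
Definition gr_lunit x : gr_hom (1 * x)%g x := GrHom (mul1g x) 0.
Definition gr_runit x : gr_hom (x * 1)%g x := GrHom (mulg1 x) 0.

Fact gr_hom_iso (x y : gr_cat) (u : hom x y) : is_iso u.
Proof.
exists (GrHom (esym (gr_hom_eq u)) (- gr_val u)).
by split; apply: gr_hom_inj; rewrite /= (addNr, addrN).
Qed.

Fact gr_tensm1 x y : gr_tensm (gr_id x) (gr_id y) = gr_id (x * y)%g.
Proof. by apply: gr_hom_inj; rewrite /= act0 addr0. Qed.

Fact gr_tensmM x x' x'' y y' y'' (u' : gr_hom x' x'') (u : gr_hom x x')
    (v' : gr_hom y' y'') (v : gr_hom y y') :
  gr_tensm (gr_comp u' u) (gr_comp v' v)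
  = gr_comp (gr_tensm u' v') (gr_tensm u v).
Proof.
apply: gr_hom_inj; rewrite /= actD.
by case: u => xx' a; case: _ / xx' u' => u' /=; rewrite addrACA.
Qed.

Fact gr_asso_nat x x' y y' z z'
    (u : gr_hom x x') (v : gr_hom y y') (w : gr_hom z z') :
  gr_comp (gr_asso x' y' z') (gr_tensm u (gr_tensm v w))
  = gr_comp (gr_tensm (gr_tensm u v) w) (gr_asso x y z).
Proof.
case: u v w => [e a] [e' b] [e'' c]; case: _ / e; case: _ / e'; case: _ / e''.
by apply: gr_hom_inj; rewrite /= actD actM addrC !addrA.
Qed.

Fact gr_lunit_nat x x' (u : gr_hom x x') :
  gr_comp (gr_lunit x') (gr_tensm (gr_id 1%g) u) = gr_comp u (gr_lunit x).
Proof. by apply: gr_hom_inj; rewrite /= act1 !add0r addr0. Qed.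

Fact gr_runit_nat x x' (u : gr_hom x x') :
  gr_comp (gr_runit x') (gr_tensm u (gr_id 1%g)) = gr_comp u (gr_runit x).
Proof. by apply: gr_hom_inj; rewrite /= act0 add0r. Qed.

Fact gr_pentagon x y z t :
  gr_comp (gr_comp (gr_tensm (gr_asso x y z) (gr_id t)) (gr_asso x (y * z)%g t))
    (gr_tensm (gr_id x) (gr_asso y z t))
  = gr_comp (gr_asso (x * y)%g z t) (gr_asso x y (z * t)%g).
Proof.
apply: gr_hom_inj; rewrite /= act0 addr0 add0r.
have /eqP/(congr1 (fun g => g [tuple x; y; z; t])) := valP h.
rewrite delta3E => h0; apply/eqP; rewrite -subr_eq0 -[X in _ == X]h0.
by rewrite opprD !addrA [X in X == _](ACl (3*4*2*5*1))%AC.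
Qed.

Fact gr_triangle x y :
  gr_comp (gr_tensm (gr_runit x) (gr_id y)) (gr_asso x 1%g y)
  = gr_tensm (gr_id x) (gr_lunit y).
Proof.
apply: gr_hom_inj; rewrite /= !act0 !add0r hn //.
by rewrite !inE eqxx orbT.
Qed.

Definition gr_mon_of_type : monoidal :=
  @Monoidal gr_cat 1%g (fun x y => (x * y)%g) gr_tensm gr_tensm1 gr_tensmM
    gr_asso gr_lunit gr_runit
    (fun _ _ _ => gr_hom_iso _) (fun _ => gr_hom_iso _) (fun _ => gr_hom_iso _)
    gr_asso_nat gr_lunit_nat gr_runit_nat gr_pentagon gr_triangle.

Fact gr_invertible_of_type (x : gr_mon_of_type) : invertible x.
Proof.
exists (x^-1)%g; split.
- by exists (GrHom (mulgV x) 0); apply: gr_hom_iso.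
- by exists (GrHom (mulVg x) 0); apply: gr_hom_iso.
Qed.

Definition gr_of_type : gr_category :=
  GrCategory gr_invertible_of_type gr_hom_iso.

End GrCategoryOfType.

Section FunctorOfType.
Variables (G G' : groupType) (A : gModule G) (A' : gModule G').
Variables (h : cocycle A 3) (hn : normalized h).
Variables (h' : cocycle A' 3) (hn' : normalized h').
Variables (phi : {multiplicative G -> G'}) (f : {additive A -> A'}).
Local Notation S := (gr_of_type hn).
Local Notation S' := (gr_of_type hn').

Definition equivariant := forall x a, f (act x a) = act (phi x) (f a).

(* As source and target of [fmap F u] are determined by [F] on objects,
   [F (x, a) = (phi x, f a)] is a condition on the [A']-component only. *)
Definition of_type (F : functor S S') :=
  (forall x : G, F x = phi x) /\
  (forall (x y : G) (u : gr_hom A x y),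
    gr_val (@fmap S S' F x y u) = f (gr_val u)).

Definition gr_functor_of_type := {K : gr_functor S S' | of_type K}.

Definition homotopicb (K L : {classic gr_functor_of_type}) : bool :=
  `[< homotopic (sval K) (sval L) >].

Fact homotopicb_equiv : equiv_class_of homotopicb.
Proof.
split=> [K|K L|L K M].
- exact/asboolP/homotopic_refl.
- by apply/asbool_equiv_eq; split; apply: homotopic_sym.
- move=> /asboolP KL /asboolP LM; apply/asboolP.
  exact: homotopic_trans KL LM.
Qed.
Canonical homotopicb_equivRel := EquivRelPack homotopicb_equiv.
Canonical homotopicb_encModRel := defaultEncModRel homotopicb.

Definition homotopy_classes : Type := {eq_quot homotopicb}.

Definition obstruction (f_equiv : equivariant) : cocycle (restr phi A') 3 :=
  pull_cocycle phi h' - @push_cocycle G A (restr phi A') f f_equiv 3 h.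

End FunctorOfType.

Definition Aut (S S' : gr_category) (K : gr_functor S S') : Type :=
  homotopy K K.

Arguments of_type {G G' A A' h} hn {h'} hn' phi f F.
Arguments homotopy_classes {G G' A A' h} hn {h'} hn' phi f.
Arguments obstruction {G G' A A'} h h' {phi f} f_equiv.
Arguments equivariant {G G' A A'} phi f.

(* Main.v *)
Require Import Defs.
From HB Require Import structures.
From mathcomp Require Import all_boot all_order all_algebra ssrAC.
From mathcomp Require Import ring_quotient.
From mathcomp Require Import boolp functions.

(* Both the tensor and the unit of a monoidal structure on a functor of type
   (phi, f) are given by elements of A', and the coherence conditions read:
   g : G^2 -> A' satisfies delta g = k, and the unit component is - g(1, 1).
   The unit axioms g(1, x) = g(1, 1) and g(x, 1) = x g(1, 1) are then automatic,
   because k is normalized.  A homotopy K -> L is a map a : G -> A' with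
   delta a = g_K - g_L; compatibility with the units again comes for free, by
   evaluating at (1, 1).  Hence subtracting a fixed solution of delta g = k
   identifies homotopy classes with H^2, and K = L gives Aut K = Z^1. *)

Set Implicit Arguments.
Unset Strict Implicit.
Unset Printing Implicit Defensive.

Import GRing.Theory.
Local Open Scope quotient_scope.
Local Open Scope ring_scope.

Lemma tuple1_eta (T : Type) (t : 1.-tuple T) : t = [tuple tnth t ord0].
Proof. by apply: eq_from_tnth => i; rewrite [i]ord1. Qed.

Lemma tuple2_eta (T : Type) (t : 2.-tuple T) :
  t = [tuple tnth t ord0; tnth t ord_max].
Proof.
by apply: eq_from_tnth; case=> [[|[|//]]] i2; congr tnth; apply: val_inj.
Qed.

Lemma tuple3_eta (T : Type) (t : 3.-tuple T) :
  exists x y z, t = [tuple x; y; z].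
Proof.
case/tupleP: t => x t; case/tupleP: t => y t; case/tupleP: t => z t.
by exists x, y, z; rewrite [t]tuple0; apply: val_inj.
Qed.

(** For a homotopy, the left side is the shape of [hcomp_tens] on [A']-components and the right side
    that of [delta1E]. *)
Lemma addr_transpose (V : zmodType) (p k l q r : V) :
  p + k = l + (q + r) <-> r - p + q = k - l.
Proof.
split=> /eqP; rewrite -subr_eq0 => e; apply/eqP; rewrite eq_sym -subr_eq0.
  by rewrite -(eqP e) !opprD opprK !addrA [X in X == _](ACl (4*1*2*5*3))%AC.
by rewrite -(eqP e) !opprD opprK !addrA [X in X == _](ACl (3*4*2*5*1))%AC.
Qed.

Lemma inj_surj_bijective (T U : Type) (b : T -> U) :
  injective b -> (forall y, exists x, b x = y) -> bijective b.
Proof.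
move=> b_inj /choice[c cK]; exists c => // x; exact/b_inj/cK.
Qed.

Lemma delta_cocycle (G : groupType) (A : gModule G) n (z : cocycle A n) :
  delta (cocycle_val z) = 0.
Proof. exact/eqP/(valP z). Qed.

Section FunctorsOfType.
Variables (G G' : groupType) (A : gModule G) (A' : gModule G').
Variables (h : cocycle A 3) (hn : normalized h).
Variables (h' : cocycle A' 3) (hn' : normalized h').
Variables (phi : {multiplicative G -> G'}) (f : {additive A -> A'}).
Hypothesis f_equiv : equivariant phi f.
Local Notation S := (gr_of_type hn).
Local Notation S' := (gr_of_type hn').
Local Notation B := (restr phi A').
Local Notation k := (obstruction h h' f_equiv).

Lemma obstructionE x y z : cocycle_val k [tuple x; y; z] =
  cocycle_val h' [tuple phi x; phi y; phi z]
  - f (cocycle_val h [tuple x; y; z]).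
Proof.
by congr (cocycle_val h' _ - _); apply: val_inj.
Qed.

Lemma obstruction_normalized : normalized k.
Proof.
move=> t; have [x [y [z ->]]] := tuple3_eta t => xyz1.
rewrite obstructionE (hn xyz1) raddf0 subr0 hn' //.
by move: xyz1; rewrite !inE => /or3P[] /eqP<-;
  rewrite multiplicative1 eqxx ?orbT.
Qed.

(** At (x, 1, y) the cocycle [k] vanishes and the two middle terms of [delta g] cancel, leaving g(x,
    1) = x g(1, y) for all x and y. Now set x = 1 or y = 1. *)
Lemma delta_obstruction_unit (g : cochain 2 B) : delta g = k ->
  (forall x, g [tuple 1%g; x] = g [tuple 1%g; 1%g]) /\
  (forall x, g [tuple x; 1%g] = act (phi x) (g [tuple 1%g; 1%g])).
Proof.
move=> dg; have gE x y : g [tuple x; 1%g] = act (phi x) (g [tuple 1%g; y]).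
  have : delta g [tuple x; 1%g; y] = 0.
    by rewrite dg obstruction_normalized // !inE eqxx orbT.
  by rewrite delta2E mulg1 mul1g subrK => /eqP; rewrite subr_eq0 => /eqP <-.
split=> x; last exact: gE.
by rewrite (gE 1%g x) multiplicative1 act1.
Qed.

(** * Monoidal structures as solutions of [delta g = k] *)

Section Structure.
Variables (K : functor S S') (K_type : of_type hn hn' phi f K).

(** [K x] and [phi x] agree only propositionally, and the types of morphisms mention [K x], so the
    rewriting is confined to [A']-valued terms. *)
Lemma of_type_act x (a : A') : act (K x : G') a = act (phi x) a.
Proof. by rewrite K_type.1. Qed.

Definition tens_cochain (s : mon_structure K) : cochain 2 B :=
  fun t => @gr_val _ A' _ _ (mtens s (tnth t ord0) (tnth t ord_max)).

Lemma of_type_cocycle x y z :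
  cocycle_val h' [tuple K x : G'; K y : G'; K z : G'] =
  cocycle_val h' [tuple phi x; phi y; phi z].
Proof. by rewrite !K_type.1. Qed.

Lemma tens_cochainE s (x y : G) :
  tens_cochain s [tuple x; y] = @gr_val _ A' _ _ (mtens s x y).
Proof. by []. Qed.

Lemma delta_tens_cochain s : delta (tens_cochain s) = k.
Proof.
apply/funext => t; have [x [y [z ->]]] := tuple3_eta t.
rewrite delta2E obstructionE !tens_cochainE /=.
have /(congr1 (@gr_val _ A' _ _)) := mtens_asso s x y z.
rewrite /= K_type.2 /= act0 addr0 of_type_act add0r of_type_cocycle => e.
apply/eqP; rewrite -subr_eq0 opprB; apply/eqP.
transitivity (f (cocycle_val h [tuple x; y; z]) + gr_val (mtens s x (y * z)%g) +
  act (phi x) (gr_val (mtens s y z)) -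
  (gr_val (mtens s (x * y)%g z) + gr_val (mtens s x y)
   + cocycle_val h' [tuple phi x; phi y; phi z])); last by rewrite e subrr.
by rewrite !opprD !addrA [RHS](ACl (3*4*2*5*1*6))%AC.
Qed.

(** In the left unit axiom at the unit object both unit constraints have component 0, so the
    components of [mtens] and [munit] cancel. *)
Lemma tens_cochain_unit (s : mon_structure K) :
  @gr_val _ A' _ _ (munit s) = - tens_cochain s [tuple 1%g; 1%g].
Proof.
have /(congr1 (@gr_val _ A' _ _)) := mtens_lunit s (1%g : G).
rewrite tens_cochainE /= K_type.2 /= act0 addr0 raddf0 add0r => /eqP.
by rewrite addrC addr_eq0 => /eqP.
Qed.

Lemma tens_cochain_surj (g : cochain 2 B) : delta g = k ->
  exists s, tens_cochain s = g.
Proof.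
move=> dg; have [g1x gx1] := delta_obstruction_unit dg.
have e2 (x y : G) : ((K x : G') * (K y : G'))%g = (K (x * y)%g : G').
  by rewrite !K_type.1 gmulfM.
have e0 : 1%g = (K (1%g : G) : G') by rewrite K_type.1 multiplicative1.
pose m (x y : G) : gr_hom A' _ _ := GrHom (e2 x y) (g [tuple x; y]).
pose c : gr_hom A' _ _ := GrHom e0 (- g [tuple 1%g; 1%g]).
unshelve eexists.
  apply: (@MonStructure S S' K m c).
  - by move=> x y; apply: gr_iso.
  - exact: gr_iso.
  (* Naturality: [u] and [v] force x = x' and y = y', so both sides carry the same value of [g], and
     equivariance of [f] matches the rest. *)
  - move=> x x' y y' u v; apply: gr_hom_inj.
    rewrite /= !K_type.2 /= of_type_act raddfD /= f_equiv.
    by case: u v => [+ a] [+ b] => /= <- <-; rewrite addrC.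
  - move=> x y z; apply: gr_hom_inj.
    rewrite /= K_type.2 /= act0 addr0 of_type_act add0r of_type_cocycle.
    (* Trading [h'] for [delta g] plus [f] of [h] reduces the associativity axiom to a
       cancellation. *)
    have -> : cocycle_val h' [tuple phi x; phi y; phi z] =
      delta g [tuple x; y; z] + f (cocycle_val h [tuple x; y; z]).
      by rewrite dg obstructionE subrK.
    by rewrite delta2E !addrA [RHS](ACl (7*5*3*1*4*2*6))%AC /= !addrK.
  - move=> x; apply: gr_hom_inj.
    by rewrite /= K_type.2 /= act0 addr0 raddf0 add0r g1x subrr.
  - move=> x; apply: gr_hom_inj.
    by rewrite /= K_type.2 /= of_type_act raddf0 !add0r gx1 actN subrr.
(* The left side computes to [g] at the pair of entries of [t]. *)
apply/funext => t; rewrite [t in RHS]tuple2_eta; exact: erefl.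
Qed.
End Structure.

(** * Homotopies as 1-cochains *)

Section Homotopies.
Variables K L : gr_functor S S'.
Hypotheses (K_type : of_type hn hn' phi f K) (L_type : of_type hn hn' phi f L).

Definition homotopy_cochain (al : homotopy K L) : cochain 1 B :=
  fun t => @gr_val _ A' _ _ (al (tnth t ord0)).

(** A morphism of [S'] with given endpoints is determined by its [A']-component, and the axioms of a
    homotopy are propositions. *)
Lemma homotopy_cochain_inj : injective homotopy_cochain.
Proof.
move=> al be e.
have {}e : al = be :> (forall X : S, Defs.hom (K X) (L X)).
  apply: functional_extensionality_dep => x; apply: gr_hom_inj.
  exact: (congr1 (fun a => a [tuple x]) e).
case: al be e => [al ? ? ? ?] [be ? ? ? ?] /= e; subst be.
by congr Homotopy; apply: Prop_irrelevance.
Qed.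

Lemma delta_homotopy_cochain al : delta (homotopy_cochain al) =
  tens_cochain (gr_struct K) - tens_cochain (gr_struct L).
Proof.
apply/funext => t; rewrite [t]tuple2_eta.
set x := tnth t ord0; set y := tnth t ord_max.
rewrite delta1E cochainBE !tens_cochainE.
have /(congr1 (@gr_val _ A' _ _)) := hcomp_tens al x y.
rewrite /= (of_type_act K_type).
by move=> /addr_transpose.
Qed.

Lemma homotopy_cochain_surj (a : cochain 1 B) :
  delta a = tens_cochain (gr_struct K) - tens_cochain (gr_struct L) ->
  exists al, homotopy_cochain al = a.
Proof.
move=> da.
have e (x : G) : (K x : G') = (L x : G') by rewrite K_type.1 L_type.1.
pose m (x : G) : gr_hom A' _ _ := GrHom (e x) (a [tuple x]).
unshelve eexists.
  apply: (@Homotopy S S' K L m).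
  - by move=> x; apply: gr_iso.
  (* Both functors act on morphisms by [f], and [u] forces x = y, so naturality is commutativity of
     [A']. *)
  - move=> x y u; apply: gr_hom_inj.
    rewrite /= K_type.2 L_type.2 addrC; congr (_ + a [tuple _]).
    by rewrite (gr_hom_eq u).
  - apply: gr_hom_inj; rewrite /= !tens_cochain_unit //.
    have := congr1 (fun d => d [tuple 1%g; 1%g]) da.
    rewrite delta1E /= mulg1 multiplicative1 act1 subrr add0r => ->.
    by rewrite cochainBE addrAC subrr add0r.
  - move=> x y; apply: gr_hom_inj; rewrite /= (of_type_act K_type).
    have := congr1 (fun d => d [tuple x; y]) da.
    rewrite delta1E cochainBE !tens_cochainE /=.
    by move=> /addr_transpose.
apply/funext => t; rewrite [t in RHS]tuple1_eta; exact: erefl.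
Qed.

Lemma homotopicP : homotopic K L <->
  is_coboundary (tens_cochain (gr_struct K) - tens_cochain (gr_struct L)).
Proof.
split=> [[al]|[a da]].
  by exists (homotopy_cochain al); apply: delta_homotopy_cochain.
by have [al _] := homotopy_cochain_surj da; constructor.
Qed.
End Homotopies.
End FunctorsOfType.

Theorem theorem2p6 (G G' : groupType) (A : gModule G) (A' : gModule G')
    (h : cocycle A 3) (hn : normalized h)
    (h' : cocycle A' 3) (hn' : normalized h')
    (phi : {multiplicative G -> G'}) (f : {additive A -> A'})
    (f_equiv : equivariant phi f)
    (F : functor (gr_of_type hn) (gr_of_type hn'))
    (F_type : of_type hn hn' phi f F) :
  let k := obstruction h h' f_equiv in
  (inhabited (mon_structure F) <-> coh_class k = 0) /\
  (coh_class k = 0 ->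
    (exists b : homotopy_classes hn hn' phi f -> cohomology (restr phi A') 2,
      bijective b) /\
    (forall K : gr_functor (gr_of_type hn) (gr_of_type hn'),
      of_type hn hn' phi f K ->
      exists b : Aut K -> cocycle (restr phi A') 1, bijective b)).
Proof.
move=> k; split.
  rewrite coh_class_eq0; split=> [[s]|[g dg]].
    by exists (tens_cochain phi s); apply: delta_tens_cochain F_type s.
  by have [s _] := tens_cochain_surj F_type dg; constructor.
move=> /coh_class_eq0[g0 dg0]; split; last first.
  move=> K K_type.
  have autP (al : Aut K) :
      homotopy_cochain phi al \in cocycle_pred (restr phi A') 1.
    by rewrite unfold_in (delta_homotopy_cochain K_type) subrr.
  exists (fun al => Cocycle (autP al)).
  apply: inj_surj_bijective => [al be /(congr1 val)|z].
    exact: homotopy_cochain_inj.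
  have dz : delta (cocycle_val z) = tens_cochain phi (gr_struct K)
                                    - tens_cochain phi (gr_struct K).
    by rewrite subrr delta_cocycle.
  have [al alz] := homotopy_cochain_surj K_type K_type dz.
  by exists al; apply: val_inj.
(* Solutions of [delta g = k] form a coset of the 2-cocycles, with [g0] as base point. *)
have diffP (K : gr_functor_of_type hn hn' phi f) :
    tens_cochain phi (gr_struct (sval K)) - g0
    \in cocycle_pred (restr phi A') 2.
  by rewrite unfold_in deltaB dg0 (delta_tens_cochain f_equiv (svalP K)) subrr.
(* The base point drops out of the difference of two shifted cochains. *)
have diff_class K L : coh_class (Cocycle (diffP K)) =
    coh_class (Cocycle (diffP L)) <-> homotopic (sval K) (sval L).
  rewrite coh_class_eq (homotopicP (svalP K) (svalP L)) /=.
  by rewrite opprB addrA subrK.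
(* [diff_class] makes the value independent of the representative and gives injectivity. *)
exists (fun c => coh_class (Cocycle (diffP (repr c)))).
apply: inj_surj_bijective => [c d /diff_class cd|y].
  rewrite -[c]reprK -[d]reprK; apply/eqmodP; exact/asboolP.
(* Surjectivity: a cocycle representing [y], shifted back by [g0], is realized as a structure on the
   given [F]. *)
have dz : delta (cocycle_val (repr y) + g0) = k.
  have := deltaB (cocycle_val (repr y) + g0) g0.
  by rewrite addrK delta_cocycle dg0 => /esym/eqP; rewrite subr_eq0 => /eqP.
have [s sz] := tens_cochain_surj F_type dz.
pose K : {classic gr_functor_of_type hn hn' phi f} :=
  exist _ (GrFunctor s) F_type.
exists (\pi_(homotopy_classes hn hn' phi f) K).
have -> : y = coh_class (Cocycle (diffP K)).
  rewrite -[y in LHS]reprK; congr coh_class; apply: val_inj.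
  by rewrite /= sz addrK.
(* The representative chosen for the class of [K] may differ from [K], but it is homotopic to
   [K]. *)
apply/diff_class/asboolP.
set L := repr _.
apply/(@eqmodP _ (homotopicb_equivRel hn hn' phi f) L K).
exact: reprK.
Qed.
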